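(* Let $r\ge2$ and let $G$ be an $r$-graph of average degree $d$ and vertex set $[n]$. Let $\mathcal{C}\subset\mathcal{P}([n])$ be such that, for every independent set $I$ of $G$, there is some $C\in\mathcal{C}$ with $I\subset C$. Suppose that $|C|\le(1-c)n$ for all $C\in\mathcal{C}$, where $c>0$. Then there is a positive constant $\gamma=\gamma(r,c)$ (depending only on $r$ and $c$) such that the following hold. (i) $|\mathcal{C}|\ge e^{\gamma nt}$, where $t=d^{-1/(r-1)}$; (ii) if $\mathcal{C}$ is internally generated and $\mathcal{C}=\{C(T):T\in\mathcal{T}\}$, then $|T|\ge\gamma tn$ for some $T\in\mathcal{T}$, and $|\mathcal{T}|\ge e^{\gamma nt\log(1/t)}$, where $t=d^{-1/(r-1)}$; (iii) if $G$ is vertex and edge transitive, and $\delta(G,\tau)\ge1$ (where $\tau>0$), then (i) and (ii) hold with $t=\tau$.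
   Context: An $r$-graph is an $r$-uniform hypergraph $G=(V(G),E(G))$; $\mathcal P(S)$ is the set of subsets of $S$; $[n]=\{1,\ldots,n\}$. A set $I\subset V(G)$ is independent if no edge of $G$ is contained in $I$. $G$ is vertex and edge transitive if its automorphism group acts transitively on the vertices and on the edges. $\mathcal{C}$ is internally generated if there is some function $C(\cdot)$ such that $\mathcal{C}=\{C(T):T\in\mathcal{T}\}$, where $\mathcal{T}\subset\mathcal{P}(V(G))$, and for every independent set $I$ there exists $T\in\mathcal{T}$ with $T\subset I\subset C(T)$. In (ii), $\mathcal T$ and $C(\cdot)$ are any such family and function. Co-degree function: let $G$ have order $n$ and average degree $d$, and let $\tau>0$. For $\sigma\subset V(G)$, $d(\sigma)$ is the number of edges containing $\sigma$. For $v\in V(G)$ and $2\le j\le r$ let $d^{(j)}(v)=\max\{d(\sigma): v\in\sigma\subset V(G),\ |\sigma|=j\}$. If $d>0$, define $\delta_j$ by $\delta_j\,\tau^{j-1}nd=\sum_v d^{(j)}(v)$, and $$\delta(G,\tau)=2^{\binom r2-1}\sum_{j=2}^r2^{-\binom{j-1}{2}}\delta_j .$$ If $d=0$, $\delta(G,\tau)=0$. *)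

(* Defs.v *)
From HB Require Import structures.
From mathcomp Require Import all_boot all_order all_algebra all_fingroup.
From mathcomp Require Import all_classical all_reals all_analysis.

Set Implicit Arguments.
Unset Strict Implicit.
Unset Printing Implicit Defensive.

Import Order.TTheory GRing.Theory Num.Theory.

Local Open Scope ring_scope.

Record uniform_hypergraph (r : nat) (V : finType) := UniformHypergraph {
  edges : {set {set V}};
  edges_card : forall e : {set V}, e \in edges -> #|e| = r
}.

Definition independent r (V : finType) (G : uniform_hypergraph r V) (I : {set V}) : bool :=
  [forall e in edges G, ~~ (e \subset I)].

Definition codeg r (V : finType) (G : uniform_hypergraph r V) (s : {set V}) : nat :=
  #|[set e in edges G | s \subset e]|.

Definition avg_deg (R : realType) r (V : finType) (G : uniform_hypergraph r V) : R :=
  (\sum_(v : V) codeg G [set v])%N%:R / #|V|%:R.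

Definition max_codeg r (V : finType) (G : uniform_hypergraph r V) (j : nat) (v : V) : nat :=
  \max_(s : {set V} | (v \in s) && (#|s| == j)) codeg G s.

Definition delta_j (R : realType) r (V : finType) (G : uniform_hypergraph r V)
    (tau : R) (j : nat) : R :=
  (\sum_(v : V) max_codeg G j v)%N%:R
    / (tau ^+ (j - 1) * #|V|%:R * avg_deg R G).

Definition codegree_function (R : realType) r (V : finType) (G : uniform_hypergraph r V)
    (tau : R) : R :=
  if avg_deg R G == 0 then 0
  else 2 ^+ ('C(r, 2) - 1) *
       \sum_(2 <= j < r.+1) 2 ^- 'C(j - 1, 2) * delta_j G tau j.

(* 'P^* is the action of permutations of V on subsets of V, and the stabiliser
   of the edge set under it consists of the permutations preserving edges. *)
Definition automorphisms r (V : finType) (G : uniform_hypergraph r V) : {set {perm V}} :=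
  'N(edges G | 'P^*)%g.

Definition vertex_transitive r (V : finType) (G : uniform_hypergraph r V) : bool :=
  [transitive automorphisms G, on [set: V] | 'P]%g.

(* False for edgeless graphs: MathComp's [transitive] requires a nonempty
   set. Such graphs have codegree_function equal to 0. *)
Definition edge_transitive r (V : finType) (G : uniform_hypergraph r V) : bool :=
  [transitive automorphisms G, on edges G | 'P^*]%g.

Definition covers_independent r (V : finType) (G : uniform_hypergraph r V)
    (CC : {set {set V}}) : Prop :=
  forall I : {set V}, independent G I -> exists2 C, C \in CC & I \subset C.

Definition internally_generated_by r (V : finType) (G : uniform_hypergraph r V)
    (CC TT : {set {set V}}) (C : {set V} -> {set V}) : Prop :=
  CC = [set C T | T in TT] /\
  forall I : {set V}, independent G I ->
    exists T, [/\ T \in TT, T \subset I & I \subset C T].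

Definition containers_lower_bound (R : realType) (V : finType)
    (CC : {set {set V}}) (gamma t : R) : Prop :=
  expR (gamma * #|V|%:R * t) <= #|CC|%:R.

Definition generators_lower_bound (R : realType) r (V : finType)
    (G : uniform_hypergraph r V) (CC : {set {set V}}) (gamma t : R) : Prop :=
  forall (TT : {set {set V}}) (C : {set V} -> {set V}),
    internally_generated_by G CC TT C ->
    (exists2 T : {set V}, T \in TT & gamma * t * #|V|%:R <= #|T|%:R) /\
    expR (gamma * #|V|%:R * t * ln (1 / t)) <= #|TT|%:R.

(* Main.v *)
Require Import Defs.
From HB Require Import structures.
From mathcomp Require Import all_boot all_order all_algebra all_fingroup.
From mathcomp Require Import all_classical all_reals all_analysis.
From mathcomp Require Import fintype finset lra ring.

Set Implicit Arguments.
Unset Strict Implicit.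
Unset Printing Implicit Defensive.

Import Order.TTheory GRing.Theory Num.Theory.

Local Open Scope ring_scope.
(** The containers are tested against a random vertex set [X], each vertex
    being kept independently with probability [p], a small multiple of [t].
    If [H] is a family of [j]-sets (j >= 2) such that every edge of [G]
    contains a member of [H], then deleting one vertex of
    [X] for each member of [H] inside [X] leaves an independent set [I].  Some
    container [C] with fingerprint [T] satisfies T <= I <= C, hence [T] lies in
    [X] and [X \ C] has at most [e(X)] elements, where [e(X)] counts the
    members of [H] inside [X].  Therefore
      exp(- e(X)) <= sum over T of [T <= X] exp(- |X \ C(T)|).
    Take expectations.  On the left, Jensen's inequality gives at least
    exp(- E e(X)); if |H| t^(j-1) <= A n then E e(X) is a small fraction of the
    mean pn.  On the right, C(T) misses at least cn vertices, so the term of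
    [T] has expectation at most p^|T| exp(- cpn/2).  This yields the master
    inequality [fingerprint_mass_ge]:
      exp(cpn/4) <= sum over T of p^|T|.

    All bounds are read off from it.  With every fingerprint empty it bounds
    the number of containers.  For genuine fingerprints, those of size at most
    [delta pn] contribute at most exp(cpn/8) ([light_mass_rate]); so some
    fingerprint is larger, and, each larger one contributing at most
    p^(delta pn), there are at least p^(- delta pn) of them as soon as
    [cpn >= 8].  For smaller means the target exp(gamma n t log(1/t)) is only a
    small power of [n], and it is beaten by |TT| >= 2 and |TT| >= cn/4; the
    latter holds because the empty set contributes at most 1 to the sum and
    every other fingerprint at most [p] ([log_count_of_small_mean]).

    This argument is [sparse_cover_bounds].  Parts (i) and (ii) apply it with
    [H] the edge set, where |H| t^(r-1) = n/r.  For part (iii), a co-degree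
    function at least 1 provides a size [j] and a [j]-set whose co-degree is at
    least a constant times tau^(j-1) d; edge transitivity plants a set
    of the same co-degree inside every edge, and [H] is the family of all
    [j]-sets of large co-degree, whose number is controlled by double
    counting. *)

(** * Random vertex sets *)

Definition hits (V : finType) (H : {set {set V}}) (X : {set V}) : {set {set V}} :=
  [set h in H | h \subset X].

Definition hit_free (V : finType) (H : {set {set V}}) (I : {set V}) : bool :=
  [forall h in H, ~~ (h \subset I)].

(** Deletion method: remove from [X] one representative of each member of [H]
    lying inside it. *)
Lemma hit_free_deletion (V : finType) (H : {set {set V}}) (X : {set V}) :
  set0 \notin H ->
  exists I : {set V}, [/\ I \subset X, hit_free H I & (#|X :\: I| <= #|hits H X|)%N].
Proof.
move=> H0; pose rep (h : {set V}) := [pick v in h].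
pose D := [set v | Some v \in rep @: hits H X].
exists (X :\: D); split; first exact: subsetDl.
  apply/forall_inP => h hH; apply/negP => hXD.
  have hX : h \in hits H X by rewrite inE hH (subset_trans hXD) ?subsetDl.
  have : rep h \in rep @: hits H X by apply: imset_f.
  rewrite /rep; case: pickP => [v vh im|h0 _].
    by have := subsetP hXD v vh; rewrite inE inE im.
  by case/negP: H0; suff <- : h = set0 by []; apply/setP => v; rewrite inE h0.
apply: leq_trans (leq_imset_card rep _).
rewrite -(card_imset _ Some_inj); apply: subset_leq_card.
apply/subsetP => _ /imsetP[v + ->]; rewrite !inE => /andP[+ vX].
by rewrite vX andbT negbK.
Qed.

Definition bernoulli_pr (R : realType) (V : finType) (p : R) (X : {set V}) : R :=
  \prod_v (if v \in X then p else 1 - p).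

(** Independence of the membership of distinct vertices: a weight that is a
    product over the vertices sums to the product of the two-term sums. *)
Lemma sum_prod_membership (R : realType) (V : finType) (a b : V -> R) :
  \sum_(X : {set V}) \prod_v (if v \in X then a v else b v) = \prod_v (a v + b v).
Proof. by rewrite bigA_distr. Qed.

Lemma bernoulli_pr_ge0 (R : realType) (V : finType) (p : R) (X : {set V}) :
  0 <= p <= 1 -> 0 <= bernoulli_pr p X.
Proof.
by move=> /andP[p0 p1]; apply: prodr_ge0 => v _; case: ifP => _ //; lra.
Qed.

Lemma sum_bernoulli_pr (R : realType) (V : finType) (p : R) :
  \sum_(X : {set V}) bernoulli_pr p X = 1.
Proof. by rewrite sum_prod_membership big1 // => v _; lra. Qed.

Lemma bernoulli_pr_prod (R : realType) (V : finType) (p : R) (a b : V -> R) :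
  \sum_(X : {set V}) bernoulli_pr p X * \prod_v (if v \in X then a v else b v)
  = \prod_v (p * a v + (1 - p) * b v).
Proof.
rewrite -sum_prod_membership; apply: eq_bigr => X _.
by rewrite -big_split; apply: eq_bigr => v _ /=; case: ifP.
Qed.

Lemma subset_indicator_prod (R : realType) (V : finType) (T X : {set V}) :
  (T \subset X)%:R = \prod_v (if v \in X then 1 else (v \notin T)%:R) :> R.
Proof.
have [TX|/subsetPn[v vT vX]] := boolP (T \subset X).
  rewrite big1 // => v _; case: ifPn => // vX.
  by rewrite (contra (subsetP TX v) vX).
by rewrite (bigD1 v) //= (negPf vX) vT mul0r.
Qed.

Lemma prod_indicator_pow (R : realType) (V : finType) (p : R) (T : {set V}) :
  \prod_v (if v \in T then p else 1) = p ^+ #|T|.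
Proof. by rewrite -big_mkcond prodr_const. Qed.

Lemma bernoulli_pr_superset (R : realType) (V : finType) (p : R) (T : {set V}) :
  \sum_(X : {set V}) bernoulli_pr p X * (T \subset X)%:R = p ^+ #|T|.
Proof.
under eq_bigr do rewrite subset_indicator_prod.
rewrite bernoulli_pr_prod -prod_indicator_pow; apply: eq_bigr => v _.
by case: (v \in T) => /=; lra.
Qed.

Lemma expected_hits (R : realType) (V : finType) (H : {set {set V}}) (p : R) (j : nat) :
  (forall h, h \in H -> #|h| = j) ->
  \sum_(X : {set V}) bernoulli_pr p X * #|hits H X|%:R = #|H|%:R * p ^+ j.
Proof.
move=> Hj.
have hitsE (X : {set V}) : #|hits H X|%:R = \sum_(h in H) (h \subset X)%:R :> R.
  rewrite -sum1_card natr_sum big_mkcond /= [RHS]big_mkcond /=.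
  by apply: eq_bigr => h _; rewrite inE; case: (h \in H); case: (h \subset X).
under eq_bigr do rewrite hitsE big_distrr /=.
rewrite exchange_big /= (eq_bigr (fun=> p ^+ j)); last first.
  by move=> h hH; rewrite bernoulli_pr_superset Hj.
by rewrite sumr_const mulr_natl.
Qed.

(** Jensen's inequality for the exponential, obtained by averaging the tangent
    line at [mu]. *)
Lemma expR_expectation_ge (R : realType) (V : finType) (p mu : R)
    (f : {set V} -> R) :
  0 <= p <= 1 -> \sum_X bernoulli_pr p X * f X <= mu ->
  expR (- mu) <= \sum_X bernoulli_pr p X * expR (- f X).
Proof.
move=> p01 fmu.
apply: (@le_trans _ _ (\sum_X bernoulli_pr p X * (expR (- mu) * (1 + mu - f X)))).
  have -> : \sum_X bernoulli_pr p X * (expR (- mu) * (1 + mu - f X)) =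
     expR (- mu) * ((1 + mu) * \sum_(X : {set V}) bernoulli_pr p X
                    - \sum_X bernoulli_pr p X * f X).
    rewrite !mulr_sumr -sumrB mulr_sumr; apply: eq_bigr => X _; ring.
  rewrite sum_bernoulli_pr ler_pMr ?expR_gt0 //; lra.
apply: ler_sum => X _; apply: ler_wpM2l; first exact: bernoulli_pr_ge0.
have -> : - f X = - mu + (mu - f X) by ring.
rewrite expRD ler_pM2l ?expR_gt0 //.
by have := expR_ge1Dx (mu - f X); lra.
Qed.

(** The expectation factors over vertices: a vertex of [T] contributes [p], a
    vertex outside [C] contributes 1 - p(1 - 1/e) <= exp(- p/2), and any
    other vertex contributes 1. *)
Lemma fingerprint_expectation_le (R : realType) (V : finType) (p m : R)
    (T C : {set V}) :
  0 <= p <= 1 -> T \subset C -> m <= #|~: C|%:R ->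
  \sum_X bernoulli_pr p X * ((T \subset X)%:R * expR (- #|X :\: C|%:R))
    <= p ^+ #|T| * expR (- (p / 2 * m)).
Proof.
move=> p01 TC mC.
pose q : R := expR (-1).
have q0 : 0 < q := expR_gt0 _.
have q12 : q <= 1 / 2.
  rewrite /q expRN ler_pdivlMr // mulrC ler_pdivrMr ?expR_gt0 //.
  by have := expR_ge1Dx (1 : R); lra.
have weightE (X : {set V}) : (T \subset X)%:R * expR (- #|X :\: C|%:R) =
    \prod_v (if v \in X then if v \in C then 1 else q else (v \notin T)%:R) :> R.
  have -> : expR (- #|X :\: C|%:R) =
      \prod_v (if v \in X then if v \in C then 1 else q else 1).
    rewrite -mulN1r mulrC expRM_natl -prod_indicator_pow.
    by apply: eq_bigr => v _; rewrite inE; case: (v \in X); case: (v \in C).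
  rewrite subset_indicator_prod -big_split; apply: eq_bigr => v _ /=.
  by case: (v \in X); rewrite ?mul1r ?mulr1.
under eq_bigr do rewrite weightE.
rewrite bernoulli_pr_prod.
apply: (@le_trans _ _ (p ^+ #|T| * (expR (- (p / 2))) ^+ #|~: C|)).
  rewrite -!prod_indicator_pow -big_split /=.
  apply: ler_prod => v _; rewrite inE.
  have := subsetP TC v; have := expR_ge1Dx (- (p / 2)).
  case: (v \in T) => [E /(_ isT) ->|E _] /=; first by apply/andP; split; lra.
  by case: (v \in C) => /=; apply/andP; split; nra.
apply: ler_wpM2l; first by apply: exprn_ge0; lra.
by rewrite -expRM_natr ler_expR mulNr lerN2; apply: ler_wpM2l; lra.
Qed.

(** * The master inequality *)

(** The families [K], [T], [C] serve both the count of containers, where [K]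
    consists of the containers and every [T S] is empty, and the count of
    fingerprints, where [T] is the identity. *)
Lemma fingerprint_mass_ge (R : realType) (V : finType) (H K : {set {set V}})
    (T C : {set V} -> {set V}) (j : nat) (p m : R) :
  0 <= p <= 1 -> set0 \notin H -> (forall h, h \in H -> #|h| = j) ->
  #|H|%:R * p ^+ j <= p * m / 4 ->
  (forall S, S \in K -> m <= #|~: C S|%:R) ->
  (forall I, hit_free H I -> exists S, [/\ S \in K, T S \subset I & I \subset C S]) ->
  expR (p * m / 4) <= \sum_(S in K) p ^+ #|T S|.
Proof.
move=> p01 H0 Hj Hp Km cov.
(* The expectation bound needs T <= C, which holds for every pair that covers
   some independent set; the other pairs are discarded. *)
pose K' := [set S in K | T S \subset C S].
have step1 : expR (- (p * m / 4)) <=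
    \sum_X bernoulli_pr p X * expR (- #|hits H X|%:R).
  by apply: expR_expectation_ge => //; rewrite (expected_hits _ Hj).
have step2 : \sum_X bernoulli_pr p X * expR (- #|hits H X|%:R) <=
    \sum_X bernoulli_pr p X *
      \sum_(S in K') ((T S \subset X)%:R * expR (- #|X :\: C S|%:R)).
  apply: ler_sum => X _; apply: ler_wpM2l; first exact: bernoulli_pr_ge0.
  have [I [IX fI cI]] := hit_free_deletion X H0.
  have [S [SK TI IC]] := cov I fI.
  rewrite (bigD1 S) /=; last by rewrite inE SK (subset_trans TI).
  rewrite (subset_trans TI IX) mul1r -[leLHS]addr0; apply: lerD.
    rewrite ler_expR lerN2 ler_nat (leq_trans _ cI) //.
    by apply: subset_leq_card; apply: setDS.
  by apply: sumr_ge0 => S' _; rewrite mulr_ge0 ?ler0n ?expR_ge0.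
have step3 : \sum_X bernoulli_pr p X *
      \sum_(S in K') ((T S \subset X)%:R * expR (- #|X :\: C S|%:R)) <=
    \sum_(S in K) p ^+ #|T S| * expR (- (p / 2 * m)).
  under eq_bigr do rewrite big_distrr /=.
  rewrite exchange_big /= big_mkcond [leRHS]big_mkcond /=; apply: ler_sum => S _.
  have p0 : 0 <= p by case/andP: p01.
  rewrite inE; case: ifP => [/andP[SK TC]|_]; last first.
    by case: ifP => _ //; rewrite mulr_ge0 ?exprn_ge0 ?expR_ge0.
  by rewrite SK; apply: fingerprint_expectation_le; rewrite ?Km.
have := le_trans step1 (le_trans step2 step3).
rewrite -mulr_suml -ler_pdivrMr ?expR_gt0 // -expRN -expRD.
by rewrite (_ : - (p * m / 4) + _ = p * m / 4) //; lra.
Qed.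

(** * Reading off the fingerprints *)

(** Exponential tilting: for [lam <= 1] a set of size at most [m] has
    1 <= lam^(|T| - m), so the sum is at most lam^(- m) (1 + lam p)^n by
    the binomial theorem. *)
Lemma light_mass_le (R : realType) (V : finType) (TT : {set {set V}})
    (lam p m : R) :
  0 < lam <= 1 -> 0 <= p ->
  \sum_(T in TT | #|T|%:R <= m) p ^+ #|T| <= expR (- ln lam * m + lam * p * #|V|%:R).
Proof.
move=> /andP[l0 l1] p0.
have L0 : 0 <= - ln lam by rewrite oppr_ge0 ln_le0.
have lpow k : lam ^+ k = expR (ln lam * k%:R) by rewrite expRM_natr lnK.
apply: (@le_trans _ _ (\sum_(T : {set V}) expR (- ln lam * m) * (lam * p) ^+ #|T|)).
  rewrite big_mkcond; apply: ler_sum => T _; case: ifP => [/andP[_ Tm]|_]; last first.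
    by rewrite mulr_ge0 ?expR_ge0 ?exprn_ge0 ?mulr_ge0 // ltW.
  rewrite exprMn mulrA ler_peMl ?exprn_ge0 // lpow -expRD.
  apply: le_trans (expR_ge1Dx _); rewrite lerDl.
  by nra.
rewrite -mulr_sumr expRD ler_pM2l ?expR_gt0 //.
under eq_bigr do rewrite -prod_indicator_pow.
rewrite sum_prod_membership prodr_const expRM_natr.
apply: lerXn2r; rewrite ?nnegrE ?expR_ge0 //; first by nra.
by rewrite addrC expR_ge1Dx.
Qed.

(** The tilting parameter: at most [c/16], so that the factor
    exp(lam p n) costs at most exp(cpn/16), and below 1 for every
    positive [c]. *)
Definition fingerprint_bias (R : realType) (c : R) : R := c / (16 * (1 + c)).

(** The constant delta for which lam^(- delta pn) = exp(cpn/16). *)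
Definition fingerprint_rate (R : realType) (c : R) : R :=
  (c / 16) / - ln (fingerprint_bias c).

Lemma fingerprint_bias_bounds (R : realType) (c : R) : 0 < c ->
  [/\ 0 < fingerprint_bias c, fingerprint_bias c < 1 & fingerprint_bias c <= c / 16].
Proof.
move=> c0; rewrite /fingerprint_bias; split.
- by apply: divr_gt0; lra.
- by rewrite ltr_pdivrMr; lra.
- by rewrite ler_pdivrMr; nra.
Qed.

Lemma ln_fingerprint_bias_gt0 (R : realType) (c : R) :
  0 < c -> 0 < - ln (fingerprint_bias c).
Proof.
move=> /fingerprint_bias_bounds[l0 l1 _].
by rewrite oppr_gt0 ln_lt0 // l0.
Qed.

Lemma fingerprint_rate_gt0 (R : realType) (c : R) : 0 < c -> 0 < fingerprint_rate c.
Proof.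
by move=> c0; rewrite divr_gt0 ?ln_fingerprint_bias_gt0 //; lra.
Qed.

Lemma light_mass_rate (R : realType) (V : finType) (TT : {set {set V}})
    (c p : R) : 0 < c -> 0 <= p ->
  \sum_(T in TT | #|T|%:R <= fingerprint_rate c * (p * #|V|%:R)) p ^+ #|T|
    <= expR (c * (p * #|V|%:R) / 8).
Proof.
move=> c0 p0; have [l0 l1 lc] := fingerprint_bias_bounds c0.
have l01 : 0 < fingerprint_bias c <= 1 by rewrite l0 ltW.
apply: le_trans (light_mass_le TT _ l01 p0) _.
rewrite ler_expR /fingerprint_rate (mulrA (- ln _)) [- ln _ * _]mulrC.
rewrite divfK ?gt_eqF ?ln_fingerprint_bias_gt0 //.
have : 0 <= p * #|V|%:R by rewrite mulr_ge0.
rewrite -(mulrA (fingerprint_bias c)).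
move: (p * _) => x x0; have := ler_wpM2r x0 lc; lra.
Qed.

Section Fingerprints.
Variables (R : realType) (V : finType) (TT : {set {set V}}) (c p : R).
Hypotheses (c_gt0 : 0 < c) (p_gt0 : 0 < p) (p_le1 : p <= 1) (V_gt0 : (0 < #|V|)%N).
Hypothesis mass : expR (c * (p * #|V|%:R) / 4) <= \sum_(T in TT) p ^+ #|T|.

Let mean_gt0 : 0 < p * #|V|%:R.
Proof. by rewrite mulr_gt0 // ltr0n. Qed.

Let light := [pred T : {set V} | #|T|%:R <= fingerprint_rate c * (p * #|V|%:R)].

Let light_mass : \sum_(T in TT | light T) p ^+ #|T| <= expR (c * (p * #|V|%:R) / 8).
Proof. exact: light_mass_rate (ltW p_gt0). Qed.

(** Were all fingerprints light, the total mass would be at most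
    exp(cpn/8), contradicting the master inequality. *)
Lemma heavy_fingerprint_exists :
  exists2 T : {set V}, T \in TT & fingerprint_rate c * (p * #|V|%:R) <= #|T|%:R.
Proof.
have [/existsP[T /andP[TTT hT]]|/existsPn all_light] :=
  boolP [exists T, (T \in TT) && ~~ light T].
  by exists T => //; rewrite ltW // ltNge.
have := le_trans mass; rewrite (bigID light) /= [X in _ + X]big1 => [|T]; last first.
  by rewrite (negPf (all_light T)).
rewrite addr0 => /(_ _ light_mass); rewrite ler_expR => ineq.
have := mulr_gt0 c_gt0 mean_gt0; lra.
Qed.

(** With y = exp(cpn/8) >= 2, the light fingerprints carry at most [y] of a
    total mass of at least y^2.  The heavy ones carry at least y^2 - y >= 1,
    and each of them weighs at most p^(delta pn). *)
Lemma card_fingerprints_large_mean : 8 <= c * (p * #|V|%:R) ->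
  expR (fingerprint_rate c * (p * #|V|%:R) * - ln p) <= #|TT|%:R.
Proof.
set x := p * _ => x8.
have heavy : \sum_(T in TT | ~~ light T) p ^+ #|T| <=
    #|TT|%:R * expR (fingerprint_rate c * x * ln p).
  rewrite mulr_natl -sumr_const big_mkcondr; apply: ler_sum => T _.
  case: ifP => [|_]; last exact: expR_ge0.
  rewrite /= -ltNge => /ltW hT; rewrite -[p in p ^+ _]lnK // -expRM_natr ler_expR mulrC.
  by apply: ler_wnM2r => //; rewrite ln_le0.
have := mass; rewrite (bigID light) /= => /le_trans /(_ (lerD light_mass heavy)).
have -> : c * x / 4 = c * x / 8 + c * x / 8 by lra.
rewrite expRD mulrN expRN -lerBlDl => ineq.
rewrite -[leLHS]mul1r ler_pdivrMr ?expR_gt0 //; apply: le_trans ineq.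
have := expR_ge1Dx (c * x / 8); nra.
Qed.

(** The empty fingerprint weighs 1 and any other at most [p], so
    1 + cpn/4 <= exp(cpn/4) <= 1 + p |TT|. *)
Lemma card_fingerprints_ge : c / 4 * #|V|%:R <= #|TT|%:R.
Proof.
have small : \sum_(T in TT) p ^+ #|T| <= 1 + #|TT|%:R * p.
  apply: (@le_trans _ _ (\sum_(T in TT) ((T == set0)%:R + p))).
    apply: ler_sum => T _; have [->|T0] := eqVneq; first by rewrite cards0 lerDl ltW.
    rewrite add0r -[leRHS]expr1; apply: ler_wiXn2l => //; first exact: ltW.
    by rewrite card_gt0.
  rewrite big_split /= sumr_const mulr_natl lerD2r -natr_sum -[leRHS]/(1%:R) ler_nat.
  rewrite big_mkcond (bigD1 set0) //= eqxx big1 ?addn0; first by case: ifP.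
  by move=> T /negPf ->; case: ifP.
have := le_trans mass small; have := expR_ge1Dx (c * (p * #|V|%:R) / 4).
move=> h1 h2; rewrite -(ler_pM2r p_gt0); lra.
Qed.

Lemma card_fingerprints_gt1 : (1 < #|TT|)%N.
Proof.
rewrite -(ltr_nat R); apply: (@lt_le_trans _ _ (expR (c * (p * #|V|%:R) / 4))).
  by rewrite expR_gt1 divr_gt0 ?mulr_gt0 // ltr0n.
apply: le_trans mass _; rewrite -sumr_const; apply: ler_sum => T _.
by apply: exprn_ile1 => //; exact: ltW.
Qed.

End Fingerprints.

(** From x log(1/x) <= 1 with x = nt one gets
    nt log(1/t) <= K log n + 1, while [N >= 2] and [N >= cn] together
    make log N at least a constant times log n + 1. *)
Lemma log_count_of_small_mean (R : realType) (c K : R) : 0 < c -> 0 <= K ->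
  exists2 gamma0 : R, 0 < gamma0 &
    forall (n N : nat) (t gamma : R), (0 < n)%N -> 0 < t -> n%:R * t <= K ->
      c * n%:R <= N%:R -> (1 < N)%N -> 0 <= gamma <= gamma0 ->
      expR (gamma * n%:R * t * ln (1 / t)) <= N%:R.
Proof.
move=> c0 K0; have l2 : 0 < ln 2 :> R by rewrite ln_gt0 //; lra.
pose b := `|ln c|; have b0 : 0 <= b := normr_ge0 _.
pose D := (K + 1) * (1 + (b + 1) / ln 2).
have q0 : 0 <= (b + 1) / ln 2 by apply: divr_ge0; lra.
have D0 : 0 < D by apply: mulr_gt0; lra.
exists D^-1; first by rewrite invr_gt0.
move=> n N t gamma n0 t0 ntK cn N1 /andP[g0 gD].
have nR : 0 < n%:R :> R by rewrite ltr0n.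
have NR : 0 < N%:R :> R by rewrite ltr0n (ltn_trans _ N1).
rewrite -[leRHS]lnK // ler_expR.
set y := ln N%:R.
have ln0 : 0 <= ln n%:R :> R by apply: ln_ge0; rewrite ler1n.
have y2 : ln 2 <= y by rewrite ler_ln ?posrE // ler_nat.
have yn : ln n%:R - b <= y.
  have : ln (c * n%:R) <= y by rewrite ler_ln ?posrE // mulr_gt0.
  by rewrite lnM ?posrE // /b; have := ler_norm (- ln c); rewrite normrN; lra.
have nt0 : 0 < n%:R * t by rewrite mulr_gt0.
have entropy : n%:R * t * ln (1 / t) <= K * ln n%:R + 1.
  have -> : ln (1 / t) = ln n%:R + ln (n%:R * t)^-1.
    by rewrite -lnM ?posrE ?invr_gt0 // invfM mulrA mulfV ?gt_eqF.
  have : ln (n%:R * t)^-1 < (n%:R * t)^-1 by rewrite ln_sublinear // invr_gt0.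
  rewrite -(ltr_pM2l nt0) mulfV ?gt_eqF // => /ltW h.
  by rewrite mulrDr lerD // ler_wpM2r.
have : ln n%:R + 1 <= y * (1 + (b + 1) / ln 2).
  have : b + 1 <= y * ((b + 1) / ln 2).
    by rewrite mulrCA ler_peMr; [|lra|rewrite ler_pdivlMr // mul1r].
  lra.
move: ((b + 1) / ln 2) @D q0 D0 gD => q /= q0 D0 gD h.
have gD1 : gamma * ((K + 1) * (1 + q)) <= 1 by rewrite -ler_pdivlMr // div1r.
have e2 : n%:R * t * ln (1 / t) <= (K + 1) * (1 + q) * y.
  apply: le_trans entropy _.
  by apply: (@le_trans _ _ ((K + 1) * (ln n%:R + 1))); nra.
rewrite -!mulrA; move: (n%:R * (t * _)) (mulrA n%:R t (ln (1 / t))) e2 => z -> e2.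
apply: le_trans (ler_wpM2l g0 e2) _.
by rewrite mulrA ler_piMl //; lra.
Qed.

(** * Covers of a sparse family *)

Lemma bounds_of_null_scale (R : realType) (r : nat) (V : finType)
    (G : uniform_hypergraph r V) (CC : {set {set V}}) (gamma t : R) :
  (0 < r)%N -> covers_independent G CC -> #|V|%:R * t = 0 ->
  containers_lower_bound CC gamma t /\ generators_lower_bound G CC gamma t.
Proof.
move=> r0 cov nt0.
have ind0 : independent G set0.
  apply/forall_inP => e eG; rewrite subset0 -cards_eq0.
  by rewrite (edges_card eG) -lt0n.
have [C0 C0C _] := cov _ ind0.
have gnt0 : gamma * #|V|%:R * t = 0 by rewrite -mulrA nt0 mulr0.
split=> [|TT C [_ gen]].
  rewrite /containers_lower_bound gnt0 expR0 ler1n card_gt0.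
  by apply/set0Pn; exists C0.
have [T [TTT _ _]] := gen _ ind0.
split; first by exists T; rewrite // mulrAC gnt0.
by rewrite gnt0 mul0r expR0 ler1n card_gt0; apply/set0Pn; exists T.
Qed.

(** Deleting one vertex from every member of [H] leaves a set that some
    container must contain. *)
Lemma card_cover_deficit_le (R : realType) (V : finType) (H CC : {set {set V}})
    (m : R) :
  set0 \notin H -> (forall C, C \in CC -> m <= #|~: C|%:R) ->
  (forall I, hit_free H I -> exists2 C, C \in CC & I \subset C) ->
  m <= #|H|%:R.
Proof.
move=> H0 CCm cov; have [I [_ fI cI]] := hit_free_deletion setT H0.
have [C CCC IC] := cov I fI; apply: le_trans (CCm C CCC) _.
rewrite ler_nat; apply: leq_trans (leq_trans _ cI) _.
  by apply: subset_leq_card; rewrite setTD setCS.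
by apply: subset_leq_card; apply/subsetP => h; rewrite inE => /andP[].
Qed.

(** The ratio p/t.  It is small enough to keep the expected number of
    members of [H] inside the random set at most cpn/4, and to make [p] at
    most 1 when t <= 1 + A/c. *)
Definition density_factor (R : realType) (A c : R) : R := c / (4 * (A + c)).

Lemma scale_le (R : realType) (A c t : R) (k : nat) :
  0 < A -> 0 < c -> 0 <= t -> (0 < k)%N -> c * t ^+ k <= A -> t <= 1 + A / c.
Proof.
move=> A0 c0 t0 k0 ctA; have Ac : 0 < A / c by apply: divr_gt0.
have [t1|t1] := leP t 1; first lra.
have : t <= A / c.
  rewrite ler_pdivlMr // mulrC; apply: le_trans ctA; rewrite ler_pM2l //.
  by rewrite -[leLHS]expr1; apply: ler_weXn2l => //; exact: ltW.
lra.
Qed.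

Lemma density_factor_bounds (R : realType) (A c : R) : 0 < A -> 0 < c ->
  [/\ 0 < density_factor A c, density_factor A c <= 1,
      density_factor A c * A <= c / 4 & density_factor A c * (1 + A / c) <= 1].
Proof.
move=> A0 c0; rewrite /density_factor; have D0 : 0 < 4 * (A + c) by lra.
have e : c / (4 * (A + c)) * (1 + A / c) = 1 / 4 by field; apply/andP; split; lra.
split; last by rewrite e; lra.
- exact: divr_gt0.
- by rewrite ler_pdivrMr //; lra.
- by rewrite mulrAC ler_pdivrMr //; nra.
Qed.

(** The constant depends neither on [j] nor on [r], since eps^(j-1) <= eps
    whenever [j >= 2]; this lets the same constant serve all parts of the
    theorem.  When [t] exceeds 1 the factor ln (1 / t) is negative
    and the bound on the number of fingerprints is trivial. *)
Lemma sparse_cover_bounds (R : realType) (A c : R) : 0 < A -> 0 < c ->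
  exists2 gamma : R, 0 < gamma &
  forall (r : nat) (V : finType) (G : uniform_hypergraph r V)
         (H CC : {set {set V}}) (j : nat) (t : R),
    (0 < r)%N -> (2 <= j)%N -> (forall h, h \in H -> #|h| = j) ->
    0 <= t -> #|H|%:R * t ^+ (j - 1) <= A * #|V|%:R ->
    (forall I, hit_free H I -> independent G I) ->
    covers_independent G CC ->
    (forall C, C \in CC -> #|C|%:R <= (1 - c) * #|V|%:R) ->
    containers_lower_bound CC gamma t /\ generators_lower_bound G CC gamma t.
Proof.
move=> A0 c0; have [eps0 eps1 epsA epsB] := density_factor_bounds A0 c0.
set eps := density_factor A c in eps0 eps1 epsA epsB.
have rate0 := fingerprint_rate_gt0 c0.
have K0 : 0 <= 8 / (c * eps) by rewrite divr_ge0 // mulr_ge0 // ltW.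
have c4 : 0 < c / 4 by lra.
have [g0 g0_gt0 logN] := log_count_of_small_mean c4 K0.
pose gamma := Num.min (c * eps / 4) (Num.min (fingerprint_rate c * eps) g0).
have gamma0 : 0 < gamma.
  rewrite !lt_min g0_gt0 (mulr_gt0 rate0) // !andbT.
  by have := mulr_gt0 c0 eps0; lra.
have gamma1 : gamma <= c * eps / 4 by rewrite ge_min lexx.
have gamma2 : gamma <= fingerprint_rate c * eps by rewrite !ge_min lexx orbT.
have gamma3 : gamma <= g0 by rewrite !ge_min lexx !orbT.
exists gamma => // r V G H CC j t r0 j2 Hj t0 Ht HG cov CCc.
have [nt0|nt_neq0] := eqVneq (#|V|%:R * t) 0; first exact: bounds_of_null_scale.
have V0 : (0 < #|V|)%N by move: nt_neq0; case: #|V| => //; rewrite mul0r eqxx.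
have n0 : 0 < #|V|%:R :> R by rewrite ltr0n.
have {nt_neq0} t_gt0 : 0 < t.
  by rewrite lt_neqAle t0 andbT; apply: contra_neq nt_neq0 => <-; rewrite mulr0.
have H0 : set0 \notin H by apply/negP => /Hj; rewrite cards0 => e; rewrite -e in j2.
have CCm C : C \in CC -> c * #|V|%:R <= #|~: C|%:R.
  by move=> /CCc; rewrite -(cardsC C) natrD => h; nra.
(* As [H] is sparse at scale [t] and yet has at least [cn] members, [t] is
   bounded; this is what makes [p] a probability. *)
have cH : c * #|V|%:R <= #|H|%:R.
  by apply: card_cover_deficit_le CCm _ => // I /HG /cov.
have j1 : (0 < j - 1)%N by rewrite subn_gt0.
have tB : t <= 1 + A / c.
  apply: (@scale_le _ _ _ _ (j - 1)) => //.
  rewrite -(ler_pM2r n0); apply: le_trans Ht.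
  by rewrite mulrAC ler_wpM2r // exprn_ge0.
pose p := eps * t.
have p0 : 0 < p by rewrite mulr_gt0.
have p1 : p <= 1 by apply: le_trans epsB; rewrite ler_pM2l.
have p01 : 0 <= p <= 1 by rewrite p1 ltW.
have Hp : #|H|%:R * p ^+ j <= p * (c * #|V|%:R) / 4.
  have -> : p ^+ j = p * p ^+ (j - 1) by rewrite -exprS subn1 prednK // ltnW.
  rewrite mulrCA -mulrA ler_pM2l // /p exprMn.
  have epsj : eps ^+ (j - 1) <= eps.
    by rewrite -[leRHS]expr1; apply: ler_wiXn2l => //; exact: ltW.
  rewrite mulrCA; apply: (@le_trans _ _ (eps * (A * #|V|%:R))).
    by apply: ler_pM => //; [rewrite exprn_ge0 // ltW | rewrite mulr_ge0 // exprn_ge0].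
  by rewrite mulrA [leRHS]mulrAC ler_wpM2r.
have mean4 : p * (c * #|V|%:R) / 4 = c * (p * #|V|%:R) / 4 by rewrite mulrCA.
split=> [|TT C [CCE gen]].
  have := @fingerprint_mass_ge R V H CC (fun=> set0) id j p _ p01 H0 Hj Hp CCm.
  rewrite mean4 cards0 expr0 sumr_const => mass.
  apply: le_trans (mass _) => [|I /HG /cov[D DC ID]]; last first.
    by exists D; rewrite sub0set.
  rewrite ler_expR (_ : c * _ / 4 = c * eps / 4 * #|V|%:R * t); last by rewrite /p; ring.
  by rewrite !ler_pM2r.
have mass : expR (c * (p * #|V|%:R) / 4) <= \sum_(T in TT) p ^+ #|T|.
  rewrite -mean4; apply: (@fingerprint_mass_ge R V H TT id C j p) => //.
    by move=> T TTT; apply: CCm; rewrite CCE; apply: imset_f.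
  by move=> I /HG /gen.
split.
  have [T TTT hT] := heavy_fingerprint_exists c0 p0 V0 mass.
  exists T => //; apply: le_trans hT.
  by rewrite (mulrA _ p) ler_pM2r // /p (mulrA _ eps) ler_pM2r.
have [large|small] := leP 8 (c * (p * #|V|%:R)).
  have [ln0|ln0] := leP (ln (1 / t)) 0.
    apply: (@le_trans _ _ 1).
      by rewrite -[leRHS]expR0 ler_expR mulr_ge0_le0 // !mulr_ge0 // ltW.
    by rewrite ler1n (ltn_trans _ (card_fingerprints_gt1 c0 p0 p1 V0 mass)).
  apply: le_trans (card_fingerprints_large_mean c0 p0 p1 mass large).
  rewrite ler_expR; apply: ler_pM => //.
  - by rewrite !mulr_ge0 // ltW.
  - exact: ltW.
  - by rewrite mulrAC (mulrA _ p) ler_pM2r // /p (mulrA _ eps) ler_pM2r.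
  rewrite div1r lnV ?posrE // lerN2 ler_ln ?posrE //.
  by rewrite /p ler_piMl // ltW.
apply: logN => //.
- rewrite ler_pdivlMr ?(mulr_gt0 c0 eps0) //; apply: ltW; apply: le_lt_trans small.
  by rewrite (_ : c * (p * _) = #|V|%:R * t * (c * eps)) // /p; ring.
- exact: card_fingerprints_ge p0 p1 mass.
- exact: card_fingerprints_gt1 c0 p0 p1 V0 mass.
- by rewrite gamma3 ltW.
Qed.

(** * Degrees and co-degrees *)

Lemma sum_codeg (r : nat) (V : finType) (G : uniform_hypergraph r V)
    (S : {set {set V}}) :
  (\sum_(s in S) codeg G s = \sum_(e in edges G) #|[set s in S | s \subset e]|)%N.
Proof.
transitivity (\sum_(s in S) \sum_(e in edges G | s \subset e) 1)%N.
  by apply: eq_bigr => s _; rewrite sum1_card -cardsE.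
rewrite (exchange_big_dep (mem (edges G))) /=; last by move=> s e _ /andP[].
by apply: eq_bigr => e eG; rewrite sum1dep_card; apply: eq_card => s; rewrite !inE eG.
Qed.

Lemma handshake (r : nat) (V : finType) (G : uniform_hypergraph r V) :
  (\sum_(v : V) codeg G [set v] = #|edges G| * r)%N.
Proof.
rewrite -(big_imset (codeg G) (in2W set1_inj)) sum_codeg.
rewrite (eq_bigr (fun=> r)) ?sum_nat_const // => e eG.
rewrite -(edges_card eG) -(card_imset e set1_inj); apply: eq_card => s.
rewrite inE; apply/andP/imsetP => [[/imsetP[v _ ->]]|[v ve ->]].
  by rewrite sub1set; exists v.
by rewrite sub1set; split => //; apply: imset_f.
Qed.

Lemma avg_deg_ge0 (R : realType) (r : nat) (V : finType) (G : uniform_hypergraph r V) :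
  0 <= avg_deg R G.
Proof. by rewrite divr_ge0. Qed.

Lemma avg_degM (R : realType) (r : nat) (V : finType) (G : uniform_hypergraph r V) :
  (0 < r)%N -> avg_deg R G * #|V|%:R = #|edges G|%:R * r%:R.
Proof.
move=> r0; rewrite /avg_deg handshake natrM.
have [V0|V0] := posnP #|V|; last by rewrite divfK // pnatr_eq0 -lt0n.
suff -> : edges G = set0 by rewrite cards0 !mul0r.
apply/setP => e; rewrite inE; apply/negP => /edges_card er.
by have := max_card (mem e); rewrite er V0 leqNgt r0.
Qed.

Lemma card_edges_scale (R : realType) (r : nat) (V : finType)
    (G : uniform_hypergraph r V) (t := avg_deg R G `^ (- (1 / (r%:R - 1)))) :
  (2 <= r)%N -> #|edges G|%:R * t ^+ (r - 1) <= #|V|%:R.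
Proof.
move=> r2; have r1 : r%:R - 1 != 0 :> R by rewrite subr_eq0 pnatr_eq1 gtn_eqF.
have r0 : (0 < r)%N by apply: leq_trans r2.
have [d0|d_neq0] := eqVneq (avg_deg R G) 0.
  rewrite /t d0 powR0 ?oppr_eq0 ?mulf_neq0 ?oner_eq0 ?invr_eq0 //.
  by rewrite expr0n subn_eq0 leqNgt r2 mulr0.
have d0 : 0 < avg_deg R G by rewrite lt_neqAle eq_sym d_neq0 avg_deg_ge0.
have -> : t ^+ (r - 1) = (avg_deg R G)^-1.
  rewrite -powR_mulrn ?powR_ge0 // -powRrM natrB // mulNr div1r mulVf //.
  by rewrite powRN powRr1 // ltW.
rewrite ler_pdivrMr // mulrC avg_degM // ler_peMr // ler1n //.
Qed.

(** If none of the fewer than [r] values delta_j reached this share, their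
    weighted sum could not reach 1. *)
Definition codegree_share (R : realType) (r : nat) : R :=
  (2 ^+ ('C(r, 2) - 1) * r%:R)^-1.

Lemma codegree_share_gt0 (R : realType) (r : nat) :
  (0 < r)%N -> 0 < codegree_share R r.
Proof. by move=> r0; rewrite invr_gt0 mulr_gt0 ?exprn_gt0 // ltr0n. Qed.

Lemma delta_j_ge0 (R : realType) (r : nat) (V : finType) (G : uniform_hypergraph r V)
    (tau : R) (j : nat) : 0 < tau -> 0 <= delta_j G tau j.
Proof.
by move=> t0; rewrite divr_ge0 // !mulr_ge0 ?exprn_ge0 ?avg_deg_ge0 // ltW.
Qed.

Lemma exists_large_delta_j (R : realType) (r : nat) (V : finType)
    (G : uniform_hypergraph r V) (tau : R) :
  (0 < r)%N -> 0 < tau -> 1 <= codegree_function G tau ->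
  exists2 j, (2 <= j <= r)%N & codegree_share R r <= delta_j G tau j.
Proof.
move=> r0 t0; rewrite /codegree_function; case: ifP => _; first by rewrite ler10.
move=> sum_ge1; apply: contrapT => no_j.
suff : \sum_(2 <= j < r.+1) 2 ^- 'C(j - 1, 2) * delta_j G tau j <
    r%:R * codegree_share R r.
  have k0 : 0 < 2 ^+ ('C(r, 2) - 1) :> R by rewrite exprn_gt0.
  rewrite -(ltr_pM2l k0) mulrA divff ?mulf_neq0 ?gt_eqF ?ltr0n //.
  by rewrite ltNge sum_ge1.
apply: (@le_lt_trans _ _ (\sum_(2 <= j < r.+1) codegree_share R r)); last first.
  rewrite sumr_const_nat -[ltLHS]mulr_natl ltr_pM2r ?codegree_share_gt0 //.
  by rewrite ltr_nat -[X in (_ < X)%N]prednK // subSS subn1.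
rewrite big_nat [leRHS]big_nat; apply: ler_sum => j; rewrite ltnS => jr.
have dj : delta_j G tau j < codegree_share R r.
  by rewrite ltNge; apply/negP => h; apply: no_j; exists j.
apply: le_trans (ltW dj); rewrite ler_piMl ?delta_j_ge0 //.
by rewrite invf_le1 ?exprn_gt0 // exprn_ege1 // ler1n.
Qed.

(** delta_j is, up to normalisation, the average over the vertices of the
    maximal co-degree, so some vertex attains the average. *)
Lemma exists_large_codeg (R : realType) (r : nat) (V : finType)
    (G : uniform_hypergraph r V) (tau k : R) (j : nat) :
  0 < avg_deg R G -> 0 < tau -> 0 < k -> k <= delta_j G tau j ->
  exists2 s : {set V}, #|s| = j & k * (tau ^+ (j - 1) * avg_deg R G) <= (codeg G s)%:R.
Proof.
move=> d0 t0 k0; set m := k * _.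
have m0 : 0 < m := mulr_gt0 k0 (mulr_gt0 (exprn_gt0 _ t0) d0).
have V0 : 0 < #|V|%:R :> R.
  rewrite lt_neqAle ler0n andbT eq_sym; apply/eqP => V0.
  by move: d0; rewrite /avg_deg V0 invr0 mulr0 ltxx.
rewrite /delta_j ler_pdivlMr; last by rewrite (mulr_gt0 _ d0) // mulr_gt0 ?exprn_gt0.
have -> : k * (tau ^+ (j - 1) * #|V|%:R * avg_deg R G) = #|V|%:R * m.
  by rewrite /m; ring.
move=> avg; apply: contrapT => no_s.
suff : (\sum_(v : V) max_codeg G j v)%N%:R < #|V|%:R * m by rewrite ltNge avg.
rewrite natr_sum mulr_natl -sumr_const.
have [v0 _] : exists v : V, v \in V by apply/card_gt0P; rewrite -(ltr0n R).
apply: ltr_sum; first by apply/hasP; exists v0; rewrite ?mem_index_enum.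
move=> v _; rewrite /max_codeg.
elim/big_ind: _ => [//|a b am bm|s /andP[_ /eqP sj]].
  by rewrite /maxn; case: ifP.
by rewrite ltNge; apply/negP => h; apply: no_s; exists s.
Qed.

Lemma codeg_imset_automorphism (r : nat) (V : finType) (G : uniform_hypergraph r V)
    (g : {perm V}) (s : {set V}) :
  g \in automorphisms G -> codeg G (g @: s) = codeg G s.
Proof.
move=> gG; rewrite /codeg -[RHS](card_imset _ (imset_inj (@perm_inj _ g))).
apply: eq_card => e.
have gE (e' : {set V}) : (g @: e' \in edges G) = (e' \in edges G).
  by have := astabs_act e' gG; rewrite /= setactE.
have [f ->] : exists f : {set V}, e = g @: f.
  exists (g^-1%g @: e); rewrite -imset_comp -[LHS]imset_id.
  by apply: eq_imset => x /=; rewrite permKV.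
rewrite mem_imset; last exact: imset_inj (@perm_inj _ g).
rewrite !inE gE; congr (_ && _).
apply/idP/idP => [/subsetP h|]; last exact: imsetS.
by apply/subsetP => x xs; have := h _ (imset_f g xs); rewrite mem_imset //; exact: perm_inj.
Qed.

(** An edge containing [s] is carried to [e] by an automorphism, which
    preserves co-degrees. *)
Lemma edge_transitive_codeg (r : nat) (V : finType) (G : uniform_hypergraph r V)
    (s e : {set V}) :
  edge_transitive G -> (0 < codeg G s)%N -> e \in edges G ->
  exists s' : {set V}, [/\ s' \subset e, #|s'| = #|s| & codeg G s' = codeg G s].
Proof.
move=> trG /card_gt0P[e0]; rewrite inE => /andP[e0G se0] eG.
have [g gG ->] := atransP2 trG e0G eG.
exists (g @: s); split; last exact: codeg_imset_automorphism.
  by rewrite /= setactE imsetS.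
by rewrite card_imset //; exact: perm_inj.
Qed.

Lemma sum_codeg_le (r : nat) (V : finType) (G : uniform_hypergraph r V)
    (S : {set {set V}}) :
  (\sum_(s in S) codeg G s <= #|edges G| * 2 ^ r)%N.
Proof.
rewrite sum_codeg -sum_nat_const; apply: leq_sum => e eG.
rewrite -(edges_card eG) -card_powerset; apply: subset_leq_card.
by apply/subsetP => s; rewrite !inE => /andP[].
Qed.

(** Sets of large co-degree are few: an edge contains at most 2^r sets, so the
    co-degrees add up to at most 2^r |E|, and r |E| = n d. *)
Lemma card_rich_sets_scale (R : realType) (r : nat) (V : finType)
    (G : uniform_hypergraph r V) (S : {set {set V}}) (k x : R) :
  (0 < r)%N -> 0 < avg_deg R G -> 0 < k ->
  (forall s, s \in S -> k * (x * avg_deg R G) <= (codeg G s)%:R) ->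
  #|S|%:R * x <= 2 ^+ r / k * #|V|%:R.
Proof.
move=> r0 d0 k0 Srich.
have count : #|S|%:R * (k * (x * avg_deg R G)) <= #|edges G|%:R * 2 ^+ r.
  apply: (@le_trans _ _ (\sum_(s in S) codeg G s)%N%:R).
    by rewrite natr_sum mulr_natl -sumr_const; apply: ler_sum.
  by rewrite -natrX -natrM ler_nat sum_codeg_le.
rewrite mulrAC ler_pdivlMr // -(ler_pM2r d0).
rewrite (_ : _ * k * _ = #|S|%:R * (k * (x * avg_deg R G))); last by ring.
apply: le_trans count _; rewrite -mulrA [_%:R * avg_deg _ _]mulrC avg_degM //.
by rewrite mulrC ler_pM2l ?exprn_gt0 // ler_peMr // ler1n.
Qed.

Theorem theorem3p8 (R : realType) (r : nat) (c : R) :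
  (2 <= r)%N -> 0 < c ->
  exists2 gamma : R, 0 < gamma &
  forall (n : nat) (G : uniform_hypergraph r 'I_n) (CC : {set {set 'I_n}}),
    covers_independent G CC ->
    (forall C, C \in CC -> #|C|%:R <= (1 - c) * n%:R) ->
    let t := avg_deg R G `^ (- (1 / (r%:R - 1))) in
    [/\ containers_lower_bound CC gamma t,
        generators_lower_bound G CC gamma t
      & forall tau : R,
          vertex_transitive G -> edge_transitive G -> 0 < tau ->
          1 <= codegree_function G tau ->
          containers_lower_bound CC gamma tau /\
          generators_lower_bound G CC gamma tau].
Proof.
move=> r2 c0; have r0 : (0 < r)%N := ltnW r2.
have k0 := codegree_share_gt0 R r0.
pose A : R := 2 ^+ r / codegree_share R r.
have A1 : 1 <= A.
  rewrite /A invrK mulrA -exprD -[leLHS]mul1r; apply: ler_pM => //.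
    by rewrite exprn_ege1 // ler1n.
  by rewrite ler1n.
have [gamma gamma0 bounds] := sparse_cover_bounds (lt_le_trans ltr01 A1) c0.
exists gamma => // n G CC cov CCc t.
have CCV C : C \in CC -> #|C|%:R <= (1 - c) * #|'I_n|%:R.
  by rewrite card_ord; exact: CCc.
have [b1 b2] : containers_lower_bound CC gamma t /\ generators_lower_bound G CC gamma t.
  apply: (bounds r _ G (edges G) CC r) => //.
  - exact: edges_card.
  - exact: powR_ge0.
  - by apply: le_trans (card_edges_scale _ _ r2) _; rewrite ler_peMl.
split=> // tau _ trG tau0 large.
have d0 : 0 < avg_deg R G.
  rewrite lt_neqAle avg_deg_ge0 andbT eq_sym; apply: contraTneq large => d0.
  by rewrite /codegree_function d0 eqxx ler10.
have [j /andP[j2 jr] kj] := exists_large_delta_j r0 tau0 large.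
have [s sj s_rich] := exists_large_codeg d0 tau0 k0 kj.
pose m := codegree_share R r * (tau ^+ (j - 1) * avg_deg R G).
have m0 : 0 < m := mulr_gt0 k0 (mulr_gt0 (exprn_gt0 _ tau0) d0).
apply: (bounds r _ G [set s' : {set 'I_n} | (#|s'| == j) && (m <= (codeg G s')%:R)] CC j) => //.
- by move=> h; rewrite inE => /andP[/eqP].
- exact: ltW.
- by apply: card_rich_sets_scale d0 k0 _ => // s'; rewrite inE => /andP[].
- move=> I /forall_inP free; apply/forall_inP => e eG; apply/negP => eI.
  have s_pos : (0 < codeg G s)%N by rewrite -(ltr0n R) (lt_le_trans m0).
  have [s' [s'e s'j s'd]] := edge_transitive_codeg trG s_pos eG.
  have /free /negP[] : s' \in [set s' : {set 'I_n} | (#|s'| == j) && (m <= (codeg G s')%:R)].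
    by rewrite inE s'j sj eqxx s'd.
  exact: subset_trans eI.
Qed.
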